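(* Let $(X,p)$ be a finitely typed generalised partial metric space. Then the categorical closure on $(X,p)$ is topological, and it is identical to the categorical closure on the associated symmetric finitely typed generalised partial metric space $(X,p_{\mathsf{s}})$, where $p_{\mathsf{s}}(y,x)=p(y,x)\vee p(x,y)$.
   Context: Here $\vee$ denotes the maximum (in the natural order) of elements of $[0,\infty]$. A generalised partial metric space $(X,p)$ is a set $X$ with a function $p\colon X\times X\to[0,\infty]$ such that $p(y,x)\ge p(x,x)\vee p(y,y)$ and $p(z,y)-p(y,y)+p(y,x)\ge p(z,x)$ for all $x,y,z\in X$. It is finitely typed if $p(x,x)<\infty$ for all $x\in X$ (but $p(x,y)=\infty$ is allowed for $x\ne y$), and symmetric if $p(x,y)=p(y,x)$. For $S\subseteq T\subseteq X$, $S$ is fully dense in $T$ if $p(y,x)=\inf_{s\in S}\big(p(y,s)-p(s,s)+p(s,x)\big)$ for all $x,y\in T$ (infimum in $[0,\infty]$ with natural order, $\inf\emptyset=\infty$). The categorical closure $\overline{S}$ of $S\subseteq X$ is the largest subset of $X$ in which $S$ is fully dense; equivalently, $x\in\overline{S}$ iff $p(x,x)\ge\inf_{s\in S}\big(p(x,s)-p(s,s)+p(s,x)\big)$. A closure is topological if $\overline{\emptyset}=\emptyset$ and $\overline{S\cup T}=\overline{S}\cup\overline{T}$ for all $S,T\subseteq X$. *)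

(* Defs.v *)
From HB Require Import structures.
From mathcomp Require Import all_boot all_order all_algebra.
From mathcomp Require Import boolp classical_sets reals constructive_ereal ereal.
From mathcomp Require Import lra.

Set Implicit Arguments.
Unset Strict Implicit.
Unset Printing Implicit Defensive.

Import Order.TTheory GRing.Theory Num.Theory DualAddTheory.

Local Open Scope classical_set_scope.
Local Open Scope ereal_scope.

(* In [%dE] arithmetic +oo absorbs -oo, so [pm_comp e +oo d] is +oo: this is
   the convention for e - b + d when b = +oo (and then e = d = +oo as well).
   With [%E] arithmetic, +oo - +oo + d would be -oo instead. For finite b and
   nonnegative e and d the two agree. *)
Definition pm_comp (R : realType) (e b d : \bar R) : \bar R :=
  (e - b + d)%dE.

Record is_gpms (R : realType) (X : Type) (p : X -> X -> \bar R) : Prop :=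
  IsGpms {
    gpms_ge0 : forall x y, 0 <= p y x ;
    gpms_diag : forall x y, maxe (p x x) (p y y) <= p y x ;
    gpms_triangle : forall x y z, p z x <= pm_comp (p z y) (p y y) (p y x)
  }.

Definition finitely_typed (R : realType) (X : Type) (p : X -> X -> \bar R) :=
  forall x, p x x < +oo.

Definition pm_symmetric (R : realType) (X : Type) (p : X -> X -> \bar R) :=
  forall x y, p x y = p y x.

Definition symmetrisation (R : realType) (X : Type) (p : X -> X -> \bar R) :
    X -> X -> \bar R :=
  fun y x => maxe (p y x) (p x y).

Definition fully_dense (R : realType) (X : Type) (p : X -> X -> \bar R)
    (S T : set X) : Prop :=
  S `<=` T /\
  forall x y, T x -> T y ->
    p y x = ereal_inf [set pm_comp (p y s) (p s s) (p s x) | s in S].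

(* The union of all the subsets in which S is fully dense; it is the largest
   of them by [cat_closure_largest]. *)
Definition cat_closure (R : realType) (X : Type) (p : X -> X -> \bar R)
    (S : set X) : set X :=
  \bigcup_(T in [set T | fully_dense p S T]) T.

Definition topological_closure (X : Type) (cl : set X -> set X) : Prop :=
  cl set0 = set0 /\ forall S T, cl (S `|` T) = cl S `|` cl T.

Lemma pm_comp_id (R : realType) (e b : \bar R) :
  0 <= b -> b <= e -> pm_comp e b b = e.
Proof.
rewrite /pm_comp !dual_addeE.
case: b => [b| |] //; case: e => [e| |] //= _ _.
by congr EFin; lra.
Qed.

Lemma fully_dense_at (R : realType) (X : Type) (p : X -> X -> \bar R)
    (S : set X) : is_gpms p ->
  fully_dense p S [set x |
    ereal_inf [set pm_comp (p x s) (p s s) (p s x) | s in S] <= p x x].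
Proof.
move=> gp; split=> [s Ss /=|x y /= Sx _].
  apply: ge_ereal_inf; exists (p s s) => //; exists s => //.
  exact: pm_comp_id (gpms_ge0 gp _ _) _.
apply/eqP; rewrite eq_le; apply/andP; split.
  by apply: le_ereal_inf_tmp => _ [s Ss <-]; exact: gpms_triangle gp _ _ _.
have := gpms_diag gp x y; rewrite ge_max => /andP[+ _].
move: Sx; have := gpms_ge0 gp x x; have := gpms_ge0 gp x y.
case pyx : (p y x) => [b| |] b0; [|by move=> *; rewrite leey|by []].
case pxx : (p x x) => [a| |] a0 Sx ab; [|by []|by []].
apply/lee_addgt0Pr => e e0.
have : ereal_inf [set pm_comp (p x s) (p s s) (p s x) | s in S] < (a + e)%:E.
  by apply: le_lt_trans Sx _; rewrite lte_fin ltrDl.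
move=> /ereal_inf_lt[_ [s Ss <-] lt_ae].
apply: ge_ereal_inf; exists (pm_comp (p y s) (p s s) (p s x)); first by exists s.
have := gpms_triangle gp s x y; rewrite pxx pyx.
move: lt_ae; rewrite /pm_comp.
have := gpms_ge0 gp s s; have := gpms_ge0 gp s x; have := gpms_ge0 gp x s.
have := gpms_ge0 gp s y.
rewrite !dual_addeE.
case: (p y s) => [ys| |] //; case: (p s s) => [ss| |] //;
case: (p x s) => [xs| |] //; case: (p s x) => [sx| |] //= _ _ _ _.
  by rewrite !lte_fin !lee_fin => h1 h2; lra.
by rewrite leNye.
Qed.

Lemma cat_closureP (R : realType) (X : Type) (p : X -> X -> \bar R)
    (S : set X) (x : X) : is_gpms p ->
  cat_closure p S x <->
  ereal_inf [set pm_comp (p x s) (p s s) (p s x) | s in S] <= p x x.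
Proof.
move=> gp; split=> [[T [_ ST] Tx]|Sx]; first by rewrite -ST.
by eexists; [exact: fully_dense_at gp|].
Qed.

Lemma cat_closure_largest (R : realType) (X : Type) (p : X -> X -> \bar R)
    (S : set X) : is_gpms p ->
  fully_dense p S (cat_closure p S) /\
  forall T, fully_dense p S T -> T `<=` cat_closure p S.
Proof.
move=> gp; split=> [|T ST x Tx]; last by exists T.
have -> : cat_closure p S = [set x |
    ereal_inf [set pm_comp (p x s) (p s s) (p s x) | s in S] <= p x x].
  by apply/funext => x; apply/propext; exact: cat_closureP.
exact: fully_dense_at.
Qed.

(* Main.v *)
Require Import Defs.
From mathcomp Require Import all_boot all_order all_algebra.
From mathcomp Require Import boolp classical_sets reals constructive_ereal ereal.
From mathcomp Require Import lra.

(** Write [l p x s] for [p x s - p s s + p s x], so that [x] lies in the closure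
    of [S] iff the infimum of [l p x s] over [s] in [S] is at most [p x x].

    Closure commutes with unions because the order is total: the infimum over a
    union is the minimum of the two infima, which is at most [p x x] iff one of
    them is ([cat_closureU]). The infimum over the empty set
    is [+oo], which finite typing keeps above [p x x] ([cat_closure0]).

    The closures for [p] and its symmetrisation [q] agree although [l p x s]
    and [l q x s] may differ. Since [p <= q] pointwise with equality on the
    diagonal, [l p <= l q], so the closure for [q] is the smaller one.
    Conversely, [p x s] and [p s x] both dominate [p x x] and [p s s]; if
    [l p x s < p x x + e], then each of them exceeds either self-distance by
    less than [e], whence [l q x s < p x x + 2 e]
    ([symmetrisation_loop_lt]). As [e] is arbitrary, the infimum for [q] is
    also at most [p x x]. *)

Set Implicit Arguments.
Unset Strict Implicit.
Unset Printing Implicit Defensive.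

Import Order.TTheory GRing.Theory Num.Theory DualAddTheory.

Local Open Scope classical_set_scope.
Local Open Scope ereal_scope.

Lemma pm_compC (R : realType) (e b d : \bar R) : pm_comp e b d = pm_comp d b e.
Proof. by rewrite /pm_comp daddeC (daddeC e) daddeA. Qed.

Lemma le_pm_comp (R : realType) (e e' b d d' : \bar R) :
  e <= e' -> d <= d' -> pm_comp e b d <= pm_comp e' b d'.
Proof. by move=> ee' dd'; rewrite /pm_comp !lee_dD. Qed.

Lemma ereal_infU_le (R : realType) (A B : set (\bar R)) (a : \bar R) :
  ereal_inf (A `|` B) <= a <-> ereal_inf A <= a \/ ereal_inf B <= a.
Proof.
split=> [ABa|[|]]; last 2 first.
- by apply: le_trans; apply: ereal_inf_le_tmp; exact: subsetUl.
- by apply: le_trans; apply: ereal_inf_le_tmp; exact: subsetUr.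
have : mine (ereal_inf A) (ereal_inf B) <= a.
  apply: le_trans ABa; apply: le_ereal_inf_tmp => y [Ay|By]; rewrite ge_min.
    by rewrite ereal_inf_lbound.
  by rewrite (ereal_inf_lbound By) orbT.
by rewrite ge_min => /orP.
Qed.

Section Closure.
Variables (R : realType) (X : Type) (p : X -> X -> \bar R).
Hypothesis p_gpms : is_gpms p.

Lemma cat_closure0 : finitely_typed p -> cat_closure p set0 = set0.
Proof.
move=> p_ft; apply/seteqP; split=> // x /(cat_closureP _ _ p_gpms).
by rewrite image_set0 ereal_inf0 leNgt p_ft.
Qed.

Lemma cat_closureU (S T : set X) :
  cat_closure p (S `|` T) = cat_closure p S `|` cat_closure p T.
Proof.
apply/funext => x; apply/propext.
rewrite /setU /= !(propext (cat_closureP _ _ p_gpms)) -[X in _ @` X]/(S `|` T).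
by rewrite image_setU; exact: ereal_infU_le.
Qed.

Lemma symmetrisation_diag x : symmetrisation p x x = p x x.
Proof. exact: maxxx. Qed.

Lemma symmetrisation_sym : pm_symmetric (symmetrisation p).
Proof. by move=> x y; exact: maxC. Qed.

Lemma le_symmetrisation x y : p x y <= symmetrisation p x y.
Proof. by rewrite le_max lexx. Qed.

Lemma symmetrisation_gpms : is_gpms (symmetrisation p).
Proof.
split=> [x y|x y|x y z].
- exact: le_trans (gpms_ge0 p_gpms x y) (le_symmetrisation _ _).
- rewrite !symmetrisation_diag.
  exact: le_trans (gpms_diag p_gpms x y) (le_symmetrisation _ _).
rewrite symmetrisation_diag {1}/symmetrisation ge_max; apply/andP; split.
  apply: le_trans (gpms_triangle p_gpms x y z) _.
  by apply: le_pm_comp; exact: le_symmetrisation.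
apply: le_trans (gpms_triangle p_gpms z y x) _; rewrite pm_compC.
by apply: le_pm_comp; rewrite symmetrisation_sym; exact: le_symmetrisation.
Qed.

Lemma symmetrisation_ft : finitely_typed p -> finitely_typed (symmetrisation p).
Proof. by move=> p_ft x; rewrite symmetrisation_diag. Qed.

(** Each leg of a short loop based at [x] exceeds [p x x] and [p s s] by less
    than [e], because the other leg dominates the other self-distance. So using
    the longer leg twice costs at most one further [e]. *)
Lemma symmetrisation_loop_lt (x s : X) (a e : R) : p x x = a%:E ->
  pm_comp (p x s) (p s s) (p s x) < (a + e)%:E ->
  pm_comp (symmetrisation p x s) (p s s) (symmetrisation p s x)
    < (a + e + e)%:E.
Proof.
move=> pxx; have := gpms_diag p_gpms s x; have := gpms_diag p_gpms x s.
rewrite (symmetrisation_sym s x) /symmetrisation /pm_comp pxx !ge_max.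
have := gpms_ge0 p_gpms s s; have := gpms_ge0 p_gpms x s.
have := gpms_ge0 p_gpms s x; rewrite !dual_addeE.
case: (p x s) => [xs| |] //; case: (p s s) => [ss| |] //;
  case: (p s x) => [sx| |] //= _ _ _ /andP[+ +] /andP[+ +].
rewrite -EFin_max /= !lee_fin !lte_fin => h1 h2 h3 h4.
by case: (leP xs sx) => h5 h6; lra.
Qed.

Lemma cat_closure_symmetrisation (S : set X) : finitely_typed p ->
  cat_closure p S = cat_closure (symmetrisation p) S.
Proof.
move=> p_ft; apply/funext => x; apply/propext.
rewrite (propext (cat_closureP _ _ p_gpms)).
rewrite (propext (cat_closureP _ _ symmetrisation_gpms)) symmetrisation_diag.
split; last first.
  apply: le_trans; apply: le_ereal_inf_tmp => _ [s Ss <-].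
  apply: ge_ereal_inf; exists (pm_comp (p x s) (p s s) (p s x)).
    by exists s.
  by rewrite symmetrisation_diag; apply: le_pm_comp; exact: le_symmetrisation.
have := gpms_ge0 p_gpms x x; have := p_ft x.
case pxx : (p x x) => [a| |] // _ _ Sx; apply/lee_addgt0Pr => e e0.
have /ereal_inf_lt[_ [s Ss <-] lt_ae] :
    ereal_inf [set pm_comp (p x s) (p s s) (p s x) | s in S]
      < (a + e / 2)%:E.
  by apply: le_lt_trans Sx _; rewrite lte_fin ltrDl divr_gt0.
have /ltW := symmetrisation_loop_lt pxx lt_ae.
rewrite -addrA -splitr EFinD; apply: le_trans; apply: ereal_inf_lbound.
by exists s => //; rewrite symmetrisation_diag.
Qed.

End Closure.

Theorem proposition5p1p1 (R : realType) (X : Type) (p : X -> X -> \bar R)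
    (p_gpms : is_gpms p) (p_ft : finitely_typed p) :
  topological_closure (cat_closure p) /\
  (is_gpms (symmetrisation p) /\ finitely_typed (symmetrisation p) /\
   pm_symmetric (symmetrisation p)) /\
  (forall S : set X, cat_closure p S = cat_closure (symmetrisation p) S).
Proof.
split; first by split; [exact: cat_closure0|exact: cat_closureU].
split; last by move=> S; exact: cat_closure_symmetrisation.
split; first exact: symmetrisation_gpms.
by split; [exact: symmetrisation_ft|exact: symmetrisation_sym].
Qed.
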